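(* Let $n\geq 1$, let $H$ be an abelian subgroup of the symmetric group $\operatorname{Sym}_n$, and let $K$ be a field. Then the Jacobson radical of the algebra $K[S_n(H)]$ is zero: $J(K[S_n(H)])=\{0\}$.
   Context: For a subset $H\subseteq \operatorname{Sym}_n$, $S_n(H)$ denotes the monoid with presentation $\langle a_1,\dots,a_n \mid a_1a_2\cdots a_n = a_{\sigma(1)}a_{\sigma(2)}\cdots a_{\sigma(n)},\ \sigma\in H\rangle$, and $K[S_n(H)]$ is its monoid algebra over $K$, i.e. the algebra $K\langle a_1,\dots,a_n\mid a_1\cdots a_n=a_{\sigma(1)}\cdots a_{\sigma(n)},\ \sigma\in H\rangle$. *)

(* Defs.v *)
From HB Require Import structures.
From mathcomp Require Import all_boot all_order all_fingroup all_algebra.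
Set Implicit Arguments. Unset Strict Implicit. Unset Printing Implicit Defensive.
Import GRing.Theory.
Local Open Scope ring_scope.

Definition left_ideal (R : pzRingType) (I : R -> Prop) : Prop :=
  [/\ I 0, (forall x y, I x -> I y -> I (x + y)) & (forall r x, I x -> I (r * x))].

Definition maximal_left_ideal (R : pzRingType) (I : R -> Prop) : Prop :=
  [/\ left_ideal I, ~ I 1 &
      forall J : R -> Prop, left_ideal J -> ~ J 1 ->
        (forall x, I x -> J x) -> forall x, J x -> I x].

Definition jacobson (R : pzRingType) (x : R) : Prop :=
  forall I : R -> Prop, maximal_left_ideal I -> I x.

Definition Sn_relations (K : fieldType) (n : nat) (H : {set 'S_n})
    (B : algType K) (b : 'I_n -> B) : Prop :=
  forall s : 'S_n, s \in H -> \prod_(i < n) b i = \prod_(i < n) b (s i).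

(* (A, a) is the K-algebra with presentation
   K< a_1, ..., a_n | a_1...a_n = a_{s(1)}...a_{s(n)}, s in H >,
   i.e. the monoid algebra K[S_n(H)], characterised by its universal property:
   a satisfies the relations and, for every K-algebra B with elements b
   satisfying the relations, there is a unique K-algebra morphism A -> B
   sending a_i to b_i. *)
Definition presents_SnH (K : fieldType) (n : nat) (H : {set 'S_n})
    (A : algType K) (a : 'I_n -> A) : Prop :=
  Sn_relations H a /\
  forall (B : algType K) (b : 'I_n -> B), Sn_relations H b ->
    exists f : {lrmorphism A -> B},
      (forall i, f (a i) = b i) /\
      forall g : {lrmorphism A -> B}, (forall i, g (a i) = b i) ->
        forall x, g x = f x.

(* Main.v *)
Require Import Defs.
From HB Require Import structures.
From mathcomp Require Import all_boot all_order all_fingroup all_algebra.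
From mathcomp Require Import boolp classical_sets.
From mathcomp Require Import generic_quotient finmap.
From mathcomp.multinomials Require Import monalg.
From mathcomp Require Import zify.
Set Implicit Arguments.
Unset Strict Implicit.
Unset Printing Implicit Defensive.

(* For each abelian H we find finitely many words u of one positive length such
   that any two nonempty finite homogeneous subsets A, B of the monoid admit a
   product s u t, with s in A and t in B, obtained in only one way.  If r is the
   sum of these words, then y r x has larger degree than y for all nonzero x and
   y, so 1 - r x has no left inverse and x lies outside the Jacobson radical.
   Call the words a_s(1)...a_s(n), s in H, windows.
   - If H is intransitive, the word of H-orbits of the letters is invariant, and
     u = b^(n-1) a^(n-1) works, with b outside the orbit of n and a outside the
     orbit of 1: no window straddles an end of u.
   - If H is transitive, it is regular, so a window is determined by any one of
     its letters.  If H does not contain the cycle c = (1 2 ... n), then u = a^4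
     works, because rewriting never pushes a window beyond the first or the last
     letter of u.
   - If H contains c and n > 2, the windows are central, and a word without
     windows is alone in its class.  One chooses s and t divisible by the least
     power of a window, and u among four words of length 4 so that the window-free
     parts of s and t keep u from creating a window.
   - If n <= 2 and H is transitive, the monoid is free commutative. *)

(** * Lists *)

Lemma prefix_split (T : eqType) (u v p w : seq T) : size u <= size p ->
  u ++ v = p ++ w -> exists r, p = u ++ r /\ v = r ++ w.
Proof.
move=> le E; exists (drop (size u) p).
have /(congr1 (take (size u))) := E; rewrite take_size_cat // takel_cat // => Eu.
have Ep : p = u ++ drop (size u) p by rewrite {1}Eu cat_take_drop.
by split=> //; move/eqP: E; rewrite {1}Ep -catA eqseq_cat // eqxx => /eqP.
Qed.

Lemma seq_argmax (T : eqType) (A : seq T) (f : T -> nat) : A != [::] ->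
  exists2 s, s \in A & forall s', s' \in A -> f s' <= f s.
Proof.
elim: A => // x [|y A] IH _.
  by exists x; rewrite ?mem_head // => s'; rewrite inE => /eqP ->.
have [//|s sA smax] := IH; case: (leqP (f x) (f s)) => c.
  exists s; first by rewrite inE sA orbT.
  by move=> s'; rewrite inE => /orP[/eqP ->|/smax].
exists x; first exact: mem_head.
by move=> s'; rewrite inE => /orP[/eqP ->|/smax /leq_trans -> //]; rewrite // ltnW.
Qed.

(** * Words up to exchange of windows *)

Section Windows.

Variables (X : eqType) (I : Type) (W : I -> nat -> X) (N : nat).

Definition win (s : I) : seq X := mkseq (W s) N.+1.

(** With [u] as a parameter, induction follows a derivation out of a fixed word, one exchange at a
    time. *)
Inductive eqv (u : seq X) : seq X -> Prop :=
| eqv_refl : eqv u u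
| eqv_step p s t q : eqv u (p ++ win s ++ q) -> eqv u (p ++ win t ++ q).

Lemma eqv_trans v u w : eqv u v -> eqv v w -> eqv u w.
Proof. by move=> uv; elim=> // p s t q _; apply: eqv_step. Qed.

Lemma eqv_sym u v : eqv u v -> eqv v u.
Proof.
elim=> [|p s t q _]; first exact: eqv_refl.
exact/eqv_trans/eqv_step/eqv_refl.
Qed.

Lemma eqv_win s t : eqv (win s) (win t).
Proof.
have := @eqv_step (win s) [::] s t [::].
by rewrite /= !cats0; apply; apply: eqv_refl.
Qed.

Lemma eqv_cat u u' v v' : eqv u u' -> eqv v v' -> eqv (u ++ v) (u' ++ v').
Proof.
move=> uu' vv'; apply: (@eqv_trans (u' ++ v)).
  elim: uu' => [|p s t q _]; first exact: eqv_refl.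
  by rewrite -!catA; apply: eqv_step.
elim: vv' => [|p s t q _]; first exact: eqv_refl.
by rewrite !(catA u' p); apply: eqv_step.
Qed.

Lemma size_win s : size (win s) = N.+1. Proof. by rewrite size_mkseq. Qed.

Lemma eqv_size u v : eqv u v -> size u = size v.
Proof. by elim=> // p s t q _ ->; rewrite !size_cat !size_win. Qed.

Lemma nth_window d p s q i : i <= N ->
  nth d (p ++ win s ++ q) (size p + i) = W s i.
Proof.
move=> iN; rewrite nth_cat; have -> : size p + i < size p = false by lia.
by rewrite addKn nth_cat size_win ltnS iN nth_mkseq.
Qed.

Lemma eqv_catl u v w : eqv v w -> eqv (u ++ v) (u ++ w).
Proof. exact/eqv_cat/eqv_refl. Qed.

Lemma eqv_catr u v w : eqv u v -> eqv (u ++ w) (v ++ w).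
Proof. by move=> uv; apply: eqv_cat uv (eqv_refl _). Qed.

Lemma eqv_rcons_cat u v x : eqv u v -> eqv (rcons u x) (rcons v x).
Proof. by rewrite -!cats1; apply: eqv_catr. Qed.

(* If no word equivalent to [u], followed by one equivalent to [v], has a
   window straddling the junction, then the junction persists. *)
Lemma eqv_cut u v w :
  (forall u' v' p s q, eqv u u' -> eqv v v' -> u' ++ v' = p ++ win s ++ q ->
     size p + N < size u' \/ size u' <= size p) ->
  eqv (u ++ v) w -> exists u' v', [/\ w = u' ++ v', eqv u u' & eqv v v'].
Proof.
move=> cut; elim=> [|p s t q _ [u' [v' [E uu' vv']]]].
  by exists u, v; split=> //; apply: eqv_refl.
case: (cut _ _ _ _ _ uu' vv' (esym E)) => [lt|le].
  have [|r [Eu Eq]] := @prefix_split _ (p ++ win s) q u' v' _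
    (etrans (esym (catA _ _ _)) E).
    by rewrite size_cat size_win addnS.
  exists ((p ++ win t) ++ r), v'; split=> //; first by rewrite Eq -!catA.
  by rewrite -catA; apply: (@eqv_step _ _ s); rewrite catA -Eu.
have [r [Ep Ev]] := @prefix_split _ u' v' p _ le (esym E).
exists u', (r ++ win t ++ q); split=> //; first by rewrite Ep -!catA.
by apply: (@eqv_step _ _ s); rewrite -Ev.
Qed.

(** Abstract form of a regular permutation group. In the last clause the positions [i], [j]
    determine the ratio of [s] and [t], stated without a group law on [I]. *)
Definition regular_windows :=
  [/\ forall s i j, i <= N -> j <= N -> W s i = W s j -> i = j,
      forall s t i, i <= N -> W s i = W t i -> s = t,
      forall x i, i <= N -> exists s, W s i = x
    & forall s t s' t' i j i' j', [&& i <= N, j <= N, i' <= N & j' <= N] ->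
        W s i = W t j -> W s i' = W t j' -> W s' i = W t' j ->
        W s' i' = W t' j'].

(** Two windows overlap in [N] letters; for a regular group this says that the cycle moving each
    position to the next belongs to it. *)
Definition shifted_window := exists s t, forall i, i < N -> W s i.+1 = W t i.

Lemma not_shifted_gt0 (s : I) : ~ shifted_window -> 0 < N.
Proof.
by move=> ns; rewrite lt0n; apply/eqP => N0; apply: ns; exists s, s => i; rewrite N0.
Qed.

Hypothesis regW : regular_windows.

Let pre s m := mkseq (W s) m.

Let winE s : win s = rcons (pre s N) (W s N).
Proof. by rewrite /win /pre mkseqS. Qed.

(** Only the exchange of a final window alters the last letter. A window is determined by its last
    letter, so successive exchanges of this kind merge into one, after a right cancellation supplied
    by the induction on length. *)
Lemma eqv_rcons_inv u x v y : eqv (rcons u x) (rcons v y) ->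
  (x = y /\ eqv u v) \/
  (exists w s t, [/\ eqv u (w ++ mkseq (W s) N), W s N = x,
                    eqv v (w ++ mkseq (W t) N) & W t N = y]).
Proof.
have [m] := ubnP (size u); elim: m => // m IH in u x v y *.
rewrite ltnS => um uv.
have canc u1 v1 l : size u1 < size u -> eqv (rcons u1 l) (rcons v1 l) -> eqv u1 v1.
  move=> lt /(IH _ _ _ _ (leq_trans lt um)) [[] //|[w [s [t [us Es vt Et]]]]].
  have E : s = t by case: regW => _ inj _ _; apply: (inj _ _ N) => //; rewrite Es.
  by rewrite E in us; apply: eqv_trans us (eqv_sym vt).
have cancpre p w t k : k <= N -> size u = size p + N ->
    eqv (p ++ pre t k) (w ++ pre t k) -> eqv p w.
  move=> + su; elim: k => [|k IHk] kN; first by rewrite !cats0.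
  rewrite /pre !mkseqS -!rcons_cat => /canc H; apply: (IHk (ltnW kN)).
  by apply: H; rewrite size_cat size_mkseq su ltn_add2l.
move E : (rcons v y) uv => z uz.
elim: uz v y E => [|p s t q uz IHz] v y.
  by move/rcons_inj=> [-> ->]; left; split=> //; apply: eqv_refl.
case/lastP: q => [|q l] in uz IHz *; last first.
  rewrite -!rcons_cat => /rcons_inj[-> ->].
  case: (IHz (p ++ win s ++ q) l); first by rewrite !rcons_cat.
    by case=> xl uq; left; split=> //; apply: eqv_step uq.
  case=> w [s' [t' [us Es vt Et]]]; right; exists w, s', t'; split=> //.
  apply: eqv_trans vt; apply: eqv_sym; apply: eqv_step; exact: eqv_refl.
rewrite cats0 winE -rcons_cat => /rcons_inj [-> ->].
have szu : size u = size p + N.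
  by have := eqv_size uz; rewrite cats0 size_cat size_win size_rcons addnS => -[].
case: (IHz (p ++ pre s N) (W s N)); first by rewrite cats0 winE rcons_cat.
  by case=> -> us; right; exists p, s, t; split=> //; apply: eqv_refl.
case=> w [s' [t' [us Es vt Et]]]; right; exists w, s', t.
have Est : t' = s by case: regW => _ inj _ _; apply: (inj _ _ N).
split=> //; apply: eqv_catr.
rewrite Est in vt; exact: (cancpre _ _ s N (leqnn _)).
Qed.

Lemma eqv_rconsI u v x : eqv (rcons u x) (rcons v x) -> eqv u v.
Proof.
move/eqv_rcons_inv => [[] //|[w [s [t [us Es vt Et]]]]].
have E : s = t by case: regW => _ inj _ _; apply: (inj _ _ N) => //; rewrite Es.
by rewrite E in us; apply: eqv_trans us (eqv_sym vt).
Qed.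

Lemma eqv_catrI u v w : eqv (u ++ w) (v ++ w) -> eqv u v.
Proof.
elim/last_ind: w => [|w x IH]; first by rewrite !cats0.
by rewrite -!rcons_cat => /eqv_rconsI /IH.
Qed.

Hypothesis no_shift : ~ shifted_window.

Let inj s t i : i <= N -> W s i = W t i -> s = t.
Proof. by case: regW => _ + _ _; apply. Qed.

Let sur x i : i <= N -> exists s, W s i = x.
Proof. by case: regW => _ _ + _; apply. Qed.

(* Consecutive ratios of windows at positions [i] and [j] agree. *)
Let same i j := exists s t, W s i = W t j /\ W s i.+1 = W t j.+1.

Let same_trans j i k : i < N -> j < N -> k < N -> same i j -> same j k -> same i k.
Proof.
move=> iN jN kN [s [t [E E1]]] [s' [t' [E' E1']]].
have [r Er] := sur (W t j) (ltnW kN).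
exists s, r; split; first by rewrite E Er.
rewrite E1; case: regW => _ _ _ /(_ s' t' t r j k j.+1 k.+1); apply=> //.
by rewrite (ltnW jN) (ltnW kN) jN.
Qed.

(* In a minimal counterexample, cancelling the common suffix of the two sides
   exposes distinct last letters, hence a shorter word ending with a window;
   by minimality the letter before that window is rigid, and comparing
   consecutive letters of windows contradicts the distinctness. *)
Lemma no_two_windows_end w v s t x : ~ eqv (w ++ win s) (rcons (v ++ win t) x).
Proof.
have [m] := ubnP (size w); elim: m => // m IH in w v s t x *.
rewrite ltnS => wm wv.
have N0 : 0 < N := not_shifted_gt0 s no_shift.
have NE : N = N.-1.+1 by rewrite prednK.
(* Replacing [win s] by the window ending in [x] lets [x] cancel; [r] is then chosen so that the new
   last letters agree. *)
have [k Ek] := sur x (leqnn N).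
have {}wv r : eqv (w ++ pre k N) (v ++ win r).
  have : eqv (w ++ win k) (rcons (v ++ win r) x).
    apply: eqv_trans (eqv_catl _ (eqv_win k s)) _; apply: eqv_trans wv _.
    by apply/eqv_rcons_cat/eqv_catl/eqv_win.
  by rewrite winE -rcons_cat Ek; apply: eqv_rconsI.
have [r Er] := sur (W k N.-1) (leqnn N); move: (wv r) => {}wv.
have sz : size w = (size v).+1.
  by have := eqv_size wv; rewrite !size_cat size_mkseq size_win addnS -addSn => /addIn.
(* [P 0] is a shifted window. It is reached by descent from [P N.-1], which holds by the choice of
   [r]. *)
pose P i := forall j, i <= j < N -> W r j.+1 = W k j.
have stepP n : n.+1 < N -> P n.+1 -> W r n.+1 = W k n.
  move=> nN Pn; apply/eqP/negPn/negP => /eqP ne.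
  have canc d : d <= N - n.+1 ->
      eqv (w ++ pre k (N - d)) (v ++ pre r (N - d).+1).
    elim: d => [|d IHd] dN; first by rewrite subn0.
    have dE : N - d = (N - d.+1).+1 by lia.
    have := IHd (ltnW dN); rewrite dE /pre mkseqS [mkseq _ _.+2]mkseqS.
    rewrite (Pn (N - d.+1)); last by lia.
    by rewrite -!rcons_cat; apply: eqv_rconsI.
  have := canc _ (leqnn _); have -> : N - (N - n.+1) = n.+1 by lia.
  rewrite /pre mkseqS [mkseq _ n.+2]mkseqS -!rcons_cat => /eqv_sym.
  case/eqv_rcons_inv => [[/ne]//|[w1 [a [b [va Ea _ _]]]]].
  have := va; rewrite mkseqS NE mkseqS -!rcons_cat.
  case/eqv_rcons_inv => [[E _]|[w2 [a' [b' [_ _ wb Eb]]]]]; last first.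
    have szw : size w1 < m.
      by have := eqv_size va; rewrite !size_cat !size_mkseq; lia.
    apply: (IH w1 w2 a b' (W a N) szw); rewrite winE -rcons_cat.
    apply: eqv_rcons_cat; rewrite winE /pre {1}NE mkseqS -!rcons_cat Eb.
    exact: eqv_rcons_cat.
  have sn : same n N.-1 by exists r, a; rewrite -NE.
  have sP d : n.+1 + d < N -> same n.+1 (n.+1 + d).
    elim: d => [|d IHd] dN; first by rewrite addn0; exists r, r.
    apply: (same_trans (j := n.+1 + d)); [lia | lia | lia | by apply: IHd; lia |].
    by exists k, r; rewrite !addnS !Pn //; lia.
  have sN : same N.-1 n.+1.
    have := sP (N.-1 - n.+1); rewrite subnKC; last by lia.
    by case=> [|a' [b' [E1 E2]]]; [lia | exists b', a'; rewrite E1 E2].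
  (* Comparing [n] with [N.-1] and [N.-1] with [n.+1] extends the shift down to [n], against
     [ne]. *)
  have [a' [b' [E0 E1]]] : same n n.+1 by apply: same_trans sn sN; lia.
  apply: ne.
  case: regW => _ _ _ /(_ b' a' r k n.+2 n.+1 n.+1 n); apply=> //; first by lia.
  by rewrite Pn //; lia.
have PN d : d < N -> P (N.-1 - d).
  elim: d => [|d IHd] dN j jN; first by have -> : j = N.-1; [lia | rewrite -NE].
  case: (ltngtP j (N.-1 - d.+1)) => [|lt|->]; first by lia.
    by apply: (IHd (ltnW dN)); lia.
  apply: stepP; first by lia.
  have -> : (N.-1 - d.+1).+1 = N.-1 - d by lia.
  by apply: IHd; lia.
apply: no_shift; exists r, k => i iN; apply: (PN N.-1); lia.
Qed.

(** If [p] ends in [a], this letter is repeated in a window. Otherwise [p] is equivalent to a word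
    ending in a window, and [rcons p a] contradicts [no_two_windows_end]. *)
Lemma no_window_ending s p x t a :
  eqv (rcons s a) p -> rcons p a = x ++ win t -> False.
Proof.
move=> sp; case/lastP: p => [|p y] in sp *.
  by have := eqv_size sp; rewrite size_rcons.
have N0 : 0 < N := not_shifted_gt0 t no_shift.
move=> E; have [ya|ya] := eqVneq y a.
  have E' : rcons (rcons p y) a = rcons (rcons (x ++ pre t N.-1) (W t N.-1)) (W t N).
    by rewrite E winE -{1}(prednK N0) /pre mkseqS !rcons_cat.
  case/rcons_inj: E' => /rcons_inj[_ E1] E2.
  case: regW => /(_ t N.-1 N) H _ _ _; have := H (leq_pred _) (leqnn _).
  by rewrite -E1 -E2 => /(_ ya); lia.
case/eqv_rcons_inv: sp => [[ay]|[w [k [l [_ _ pl El]]]]].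
  by rewrite ay eqxx in ya.
apply: (@no_two_windows_end x w t l a); rewrite -E; apply: eqv_rcons_cat.
by rewrite winE -rcons_cat -El; apply: eqv_rcons_cat.
Qed.

End Windows.

(** * Reversal of words and windows *)

Section Reversal.

Variables (X : eqType) (I : Type) (W : I -> nat -> X) (N : nat).

Definition rev_windows s i := W s (N - i).

Lemma win_rev s : win rev_windows N s = rev (win W N s).
Proof.
apply: (@eq_from_nth _ (W s 0)); rewrite ?size_rev !size_mkseq // => i iN.
by rewrite nth_rev size_mkseq // !nth_mkseq //; lia.
Qed.

Lemma eqv_rev u v : eqv W N u v -> eqv rev_windows N (rev u) (rev v).
Proof.
elim=> [|p s t q _]; first exact: eqv_refl.
by rewrite !rev_cat -!win_rev -!catA; apply: eqv_step.
Qed.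

Lemma regular_windows_rev :
  regular_windows W N -> regular_windows rev_windows N.
Proof.
move=> [un inj sur rat]; split=> [s i j iN jN|s t i iN|x i iN|s t s' t' i j i' j' H].
- by move=> E; have := un s (N - i) (N - j) (leq_subr _ _) (leq_subr _ _) E; lia.
- exact/inj/leq_subr.
- exact/sur/leq_subr.
by apply: rat; rewrite !leq_subr.
Qed.

Lemma shifted_window_rev : shifted_window rev_windows N -> shifted_window W N.
Proof.
move=> [s [t st]]; exists t, s => i iN.
have := st (N - i.+1); rewrite /rev_windows.
have -> : N - (N - i.+1).+1 = i by lia.
have -> : N - (N - i.+1) = i.+1 by lia.
by move=> H; apply/esym/H; lia.
Qed.

End Reversal.

(** * Separating words and unique products *)

Section Codes.

Variables (X : eqType) (I : Type) (W : I -> nat -> X) (N : nat).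

Local Notation eqv := (eqv W N).

Definition separating (u : seq X) := forall s t s' t', size s = size s' ->
  eqv (s ++ u ++ t) (s' ++ u ++ t') -> eqv s s' /\ eqv t t'.

Lemma eqv_consI x u v : regular_windows W N ->
  eqv (x :: u) (x :: v) -> eqv u v.
Proof.
move=> /regular_windows_rev reg /eqv_rev; rewrite !rev_cons => /(eqv_rconsI reg).
move/eqv_rev; rewrite !revK; elim=> [|p s t q _]; first exact: eqv_refl.
(* Reversing twice restores [W] at positions up to [N] only, hence an equality of windows and not of
   functions. *)
have E r : @mkseq X (rev_windows (rev_windows W N) N r) N.+1 = win W N r.
  apply: (@eq_from_nth _ (W r 0)); rewrite !size_mkseq // => i iN.
  by rewrite !nth_mkseq // /rev_windows; congr W; lia.
by rewrite /win !E; apply: eqv_step.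
Qed.

Lemma no_window_starting s q y t a :
  regular_windows W N -> ~ shifted_window W N ->
  eqv (a :: s) q -> a :: q = win W N t ++ y -> False.
Proof.
move=> reg ns /eqv_rev; rewrite rev_cons => sq E.
apply: (@no_window_ending _ _ _ _ (regular_windows_rev reg) _ _ _ (rev y) t a sq).
  by move=> /shifted_window_rev.
by rewrite -rev_cons E rev_cat win_rev.
Qed.

(** The two middle letters stay in place throughout a derivation; the outer two are absorbed into
    the sides, so that each side still has an [a] next to the middle. *)
Lemma separating_power a : regular_windows W N -> ~ shifted_window W N ->
  separating [:: a; a; a; a].
Proof.
move=> reg ns.
have sand s t w : eqv (s ++ [:: a; a; a; a] ++ t) w -> exists p q,
    [/\ w = p ++ [:: a; a] ++ q, eqv (rcons s a) p & eqv (a :: t) q].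
  elim=> [|x k l y _ [p [q [E sp tq]]]].
    by exists (rcons s a), (a :: t); rewrite cat_rcons; split=> //; apply: eqv_refl.
  have N0 : 0 < N := not_shifted_gt0 k ns.
  case: (leqP (size x + N.+1) (size p)) => [le|lt].
    have [|r [Ep Eq]] := @prefix_split _ (x ++ win W N k) y p
      ([:: a; a] ++ q) _ (etrans (esym (catA _ _ _)) E).
      by rewrite size_cat size_win.
    exists ((x ++ win W N l) ++ r), q; split=> //; first by rewrite Eq -!catA.
    by rewrite -catA; apply: (@eqv_step _ _ _ _ _ _ k); rewrite catA -Ep.
  case: (leqP (size p + 2) (size x)) => [le|lt'].
    have [|r [Ep Eq]] := @prefix_split _ (p ++ [:: a; a]) q x
      (win W N k ++ y) _ (etrans (esym (catA _ _ _)) (esym E)).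
      by rewrite size_cat.
    exists p, (r ++ win W N l ++ y); split=> //; first by rewrite Ep -!catA.
    by apply: (@eqv_step _ _ _ _ _ _ k); rewrite -Eq.
  (* The window starts at the second middle [a]. *)
  have [Ex|nx] := eqVneq (size x) (size p).+1.
    have [|r [Ep Eq]] := @prefix_split _ (rcons p a) (a :: q) x
      (win W N k ++ y) _ (etrans (cat_rcons _ _ _) (esym E)).
      by rewrite size_rcons Ex.
    have r0 : r = [::].
      apply/size0nil; have := congr1 size Ep.
      by rewrite size_cat size_rcons Ex; lia.
    by rewrite r0 in Eq; case: (no_window_starting reg ns tq Eq).
  (* The window ends at the first middle [a]. *)
  have [Ex|ny] := eqVneq (size x + N) (size p).
    have [|r [Ep Eq]] := @prefix_split _ (x ++ win W N k) y (rcons p a) (a :: q) _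
      (etrans (esym (catA _ _ _)) (etrans E (esym (cat_rcons _ _ _)))).
      by rewrite size_cat size_win size_rcons addnS Ex.
    have r0 : r = [::].
      apply/size0nil; have := congr1 size Ep.
      by rewrite !size_cat size_win size_rcons; lia.
    by rewrite r0 cats0 in Ep; case: (no_window_ending reg ns sp Ep).
  (* The window now contains both middle letters, but the letters of a window are distinct. *)
  have W2 e : e < 2 -> W k (size p - size x + e) = a.
    move=> e2; rewrite -(@nth_window _ _ W N a x k y); last by lia.
    rewrite E nth_cat.
    have -> : size x + (size p - size x + e) < size p = false by lia.
    have -> : size x + (size p - size x + e) - size p = e by lia.
    by case: e e2 => [|[]].
  case: reg => un _ _ _.
  have := un k (size p - size x + 0) (size p - size x + 1).
  by rewrite !W2 // => H; have := H _ _ erefl; lia.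
move=> s t s' t' ss /sand [p [q [E sp tq]]].
have sE : size (rcons s' a) = size p by rewrite -(eqv_size sp) !size_rcons ss.
have : rcons s' a ++ [:: a; a] ++ a :: t' == p ++ [:: a; a] ++ q.
  by rewrite cat_rcons -E.
rewrite eqseq_cat // => /andP[/eqP Ep]; rewrite eqseq_cat // eqxx => /eqP Eq.
rewrite -Ep in sp; rewrite -Eq in tq.
by split; [apply: eqv_rconsI sp | apply: eqv_consI tq].
Qed.

(** A window has [N.+1] letters: straddling the right end of the word it starts among the letters
    [a], and straddling the left end it ends among the letters [b]. The invariant word of classes
    excludes both. *)
Lemma separating_class (T : eqType) (cls : X -> T) a b :
  (forall s t i, i <= N -> cls (W s i) = cls (W t i)) ->
  (forall s, cls (W s 0) <> cls a) -> (forall s, cls (W s N) <> cls b) ->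
  separating (nseq N b ++ nseq N a).
Proof.
move=> clsW ca cb.
have inv u v : eqv u v -> map cls u = map cls v.
  elim=> // p s t q _ ->; rewrite !map_cat; congr (_ ++ (_ ++ _)).
  apply: (@eq_from_nth _ (cls a)); rewrite !(size_map cls) !size_win // => i iN.
  by rewrite !(nth_map a) ?size_win // !nth_mkseq //; apply: clsW.
have letter u v p k q i : i <= N -> u ++ v = p ++ win W N k ++ q ->
    nth (cls a) (map cls u ++ map cls v) (size p + i) = cls (W k i).
  move=> iN E; rewrite -map_cat E (nth_map a) ?nth_window //.
  by rewrite !size_cat size_win; lia.
move=> s t s' t' ss; rewrite !catA => H.
have [|u [v [E su tv]]] := eqv_cut _ H.
  move=> u v p k q su tv E; case: (ltnP (size p + N) (size u)); first by left.
  case: (leqP (size u) (size p)); first by right.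
  move=> pu up; have := letter _ _ _ _ _ _ (leq0n N) E.
  rewrite addn0 -(inv _ _ su) !map_cat !nth_cat !size_cat !size_map.
  have := eqv_size su; rewrite !size_cat !size_nseq => szu.
  have -> : size p < size s + N + N by lia.
  have -> : size p < size s + N = false by lia.
  by rewrite map_nseq nth_nseq; case: ifP => [_ /esym/ca|] //; lia.
have szu : size ((s' ++ nseq N b) ++ nseq N a) = size u.
  by rewrite -(eqv_size su) !size_cat ss.
move/eqP: E; rewrite eqseq_cat // => /andP[/eqP Eu /eqP Ev].
rewrite -Ev in tv; split=> //.
move: su; rewrite -Eu -!catA => {H}H.
have [|u1 [v1 [E1 su1 tv1]]] := eqv_cut _ H.
  move=> u1 v1 p k q su1 tv1 E; case: (ltnP (size p + N) (size u1)); first by left.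
  case: (leqP (size u1) (size p)); first by right.
  move=> pu up; have := letter _ _ _ _ _ _ (leqnn N) E.
  rewrite nth_cat size_map ltnNge up /= -(inv _ _ tv1) map_cat nth_cat.
  rewrite size_map size_nseq map_nseq nth_nseq.
  case: ifP => [c1 E1|]; last by lia.
  by case: (cb k); rewrite -E1 ?c1.
move/eqP: E1; rewrite eqseq_cat; first by case/andP => /eqP->.
by rewrite -ss (eqv_size su1).
Qed.

(** Lists of representatives stand for finite sets of classes. The middle factor is unique
    literally, as distinct words of [U] will be distinct summands. *)
Definition unique_products (U : seq (seq X)) := forall (A B : seq (seq X)) e d,
  A != [::] -> B != [::] ->
  (forall s, s \in A -> size s = e) -> (forall t, t \in B -> size t = d) ->
  exists s t u, [/\ s \in A, t \in B, u \in U &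
    forall s' t' u', s' \in A -> t' \in B -> u' \in U ->
      eqv (s' ++ u' ++ t') (s ++ u ++ t) -> [/\ eqv s' s, eqv t' t & u' = u]].

Lemma separating_unique u : separating u -> unique_products [:: u].
Proof.
move=> sep [|s A] [|t B] // e d _ _ Ae Bd.
exists s, t, u; rewrite !mem_head; split=> // s' t' u' As' Bt'.
rewrite inE => /eqP -> /sep[]; last by [].
by rewrite (Ae _ As') Ae ?mem_head.
Qed.

Lemma eqv_perm u v :
  (forall x y, eqv [:: x; y] [:: y; x]) -> perm_eq u v -> eqv u v.
Proof.
move=> comm; elim: u v => [|x u IH] v.
  by rewrite perm_sym => /perm_nilP ->; apply: eqv_refl.
move=> uv; have xv : x \in v by rewrite -(perm_mem uv) mem_head.
case/splitPr: xv uv => p q; rewrite perm_sym -[x :: q]cat1s perm_catCA.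
rewrite /= perm_cons perm_sym.
move/IH => /(eqv_catl [:: x]) H; apply: eqv_trans H _; rewrite catA -cat_rcons.
apply: eqv_catr; elim: p => [|y p IHp] /=; first exact: eqv_refl.
apply: (@eqv_trans _ _ _ _ ([:: y; x] ++ p)).
  exact: (eqv_catr p (comm x y)).
exact: (eqv_catl [:: y] IHp).
Qed.

(** Over at most two letters, length and number of letters [a] determine a class; members of [A] and
    [B] with the most letters [a] give the unique product. *)
Lemma unique_products_count a :
  (forall s t, perm_eq (win W N s) (win W N t)) ->
  (forall x y, eqv [:: x; y] [:: y; x]) ->
  (forall x y, x != a -> y != a -> x = y) -> unique_products [:: [:: a]].
Proof.
move=> permW comm two.
have inv u v : eqv u v -> perm_eq u v.
  elim=> [|p s t q _ H]; first exact: perm_refl.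
  by apply: perm_trans H _; rewrite perm_cat2l perm_cat2r.
have eqvP u v : size u = size v -> count_mem a u = count_mem a v -> eqv u v.
  move=> suv cuv; apply: eqv_perm => //; apply/allP => x _ /=; apply/eqP.
  have [->//|xa] := eqVneq x a.
  have cx w : count_mem x w = size w - count_mem a w.
    rewrite -(count_predC (pred1 a)) addKn; apply: eq_count => y /=.
    have [->|ya] := eqVneq y a; first by rewrite eq_sym (negbTE xa).
    by rewrite (two x y xa ya) eqxx.
  by rewrite !cx suv cuv.
move=> A B e d /(@seq_argmax _ _ (count_mem a))[s sA smax].
move=> /(@seq_argmax _ _ (count_mem a))[t tB tmax] Ae Bd.
exists s, t, [:: a]; split=> // [|s' t' u' sA' tB']; first exact: mem_head.
rewrite inE => /eqP -> /inv /seq.permP /(_ (pred1 a)); rewrite !count_cat => E.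
have := smax _ sA'; have := tmax _ tB' => ct cs.
split=> //; apply: eqvP; [|lia| |lia].
  by rewrite (Ae _ sA) (Ae _ sA').
by rewrite (Bd _ tB) (Bd _ tB').
Qed.

(** * Windows closed under rotation *)

Section Cyclic.

Variable nxt : X -> X.
Hypothesis regW : regular_windows W N.
Hypothesis nxtW : forall s i, i < N -> W s i.+1 = nxt (W s i).
Hypothesis rotW : forall s, exists2 t,
  forall i, i < N -> W t i = W s i.+1 & W t N = W s 0.

(** A window starting with [x] is [x m], and its rotation [m x] is a window too, so windows move
    past any letter [x]. *)
Let commute_win s w : eqv (win W N s ++ w) (w ++ win W N s).
Proof.
elim: w => [|x w IH]; first by rewrite cats0; apply: eqv_refl.
apply: eqv_trans (eqv_catl [:: x] IH); rewrite -cat1s !catA; apply: eqv_catr.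
have [r Er] : exists r, W r 0 = x by case: regW => _ _ /(_ x 0) H _; apply: H.
have [t tr tN] := rotW r.
have rE : win W N r = x :: mkseq (W t) N.
  rewrite /win /mkseq /= -[1]addn0 iotaDl -map_comp Er; congr (_ :: _).
  by apply/eq_in_map => i; rewrite mem_iota => /tr ->.
have tE : win W N t = mkseq (W t) N ++ [:: x].
  by rewrite /win mkseqS tN Er cats1.
apply: (@eqv_trans _ _ _ _ (win W N r ++ [:: x])).
  exact/eqv_catr/eqv_win.
by rewrite rE cat_cons -tE -cat1s; apply: eqv_catl; apply: eqv_win.
Qed.

Let reduced w := forall p s q, w <> p ++ win W N s ++ q.

Let reduced_eqv w v : reduced w -> eqv w v -> v = w.
Proof. by move=> red; elim=> // p s t q _ /esym /red. Qed.

Let reducedPn w : ~ reduced w -> exists p s q, w = p ++ win W N s ++ q.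
Proof.
move=> nred; case: (EM (exists p s q, w = p ++ win W N s ++ q)) => // H.
by case: nred => p s q E; apply: H; exists p, s, q.
Qed.

(** Inside a window each letter is [nxt] of its predecessor, so no window straddles the junction. *)
Let reduced_cat u x y v : reduced (rcons u x) -> reduced (y :: v) ->
  y <> nxt x -> reduced (rcons u x ++ y :: v).
Proof.
move=> redu redv yx p s q E.
case: (leqP (size (p ++ win W N s)) (size (rcons u x))) => [le|].
  have [r [Er _]] := prefix_split le (etrans (esym (catA _ _ _)) (esym E)).
  by apply: (redu p s r); rewrite catA.
case: (leqP (size (rcons u x)) (size p)) => [le _|].
  by have [r [_ Er]] := prefix_split le E; apply: (redv _ _ _ Er).
rewrite size_cat size_win size_rcons => pu up; apply: yx.
have H i : i <= N -> nth x (rcons u x ++ y :: v) (size p + i) = W s i.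
  by rewrite E; apply: nth_window.
have := H (size u - size p); have := H (size u - size p).+1.
rewrite addnS subnKC // cat_rcons !nth_cat ltnn subnn.
have -> : (size u).+1 < size u = false by lia.
rewrite subSnn /= => -> ; last by lia.
by move=> ->; [apply: nxtW |]; lia.
Qed.

Let reduced_rcons w x d : 0 < N -> reduced w -> ~ reduced (rcons w x) ->
  x = nxt (last d w).
Proof.
move=> N0 red /reducedPn [p [s [q]]]; case/lastP: q => [|q y].
  rewrite cats0 /win mkseqS -(prednK N0) mkseqS -!rcons_cat.
  by move=> /rcons_inj[-> ->]; rewrite last_rcons nxtW // prednK.
by rewrite -!rcons_cat => /rcons_inj[/red].
Qed.

Let reduced_cons w x : 0 < N -> reduced w -> ~ reduced (x :: w) ->
  head x w = nxt x.
Proof.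
move=> N0 red /reducedPn [[|y p] [s [q]]]; last by case=> _ /red.
rewrite /win -(prednK N0) /mkseq /= => -[-> ->] /=.
by rewrite nxtW.
Qed.

Let power k s := flatten (nseq k (win W N s)).

Let commute_power k s w : eqv (power k s ++ w) (w ++ power k s).
Proof.
elim: k => [|k IH]; first by rewrite cats0; apply: eqv_refl.
rewrite -[power k.+1 s]/(win W N s ++ power k s) -catA.
apply: eqv_trans (eqv_catl _ IH) _.
by rewrite !catA; apply: eqv_catr; apply: commute_win.
Qed.

(** Otherwise windows could be split off every member of [A] without end, against the common length
    [e]. *)
Let max_power z (A : seq (seq X)) e : A != [::] ->
  (forall s, s \in A -> size s = e) ->
  exists k s w, [/\ s \in A, reduced w, eqv s (w ++ power k z) &
    forall s', s' \in A -> exists w', eqv s' (w' ++ power k z)].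
Proof.
move=> A0 Ae; match goal with |- ?G => case: (EM G) => // ng end.
have all k : forall s, s \in A -> exists w, eqv s (w ++ power k z).
  elim: k => [|k IH] s sA; first by exists s; rewrite cats0; apply: eqv_refl.
  have [w sw] := IH s sA.
  have /reducedPn[p [r [q Ew]]] : ~ reduced w.
    by move=> red; apply: ng; exists k, s, w.
  exists (p ++ q); apply: eqv_trans sw _.
  rewrite -[power k.+1 z]/(win W N z ++ power k z) Ew [(p ++ q) ++ _]catA.
  apply: eqv_catr; rewrite -!catA.
  apply: eqv_catl; apply: eqv_trans (commute_win _ _) _.
  exact/eqv_catl/eqv_win.
case: A A0 Ae all ng => // s A _ Ae /(_ e.+1 s (mem_head _ _)) [w].
move/eqv_size; rewrite (Ae s) ?mem_head // size_cat /power size_flatten.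
by rewrite /shape map_nseq sumn_nseq size_win => E; exfalso; nia.
Qed.

Lemma unique_products_cyclic a b : 1 < N -> b = nxt a -> a <> b ->
  a <> nxt b -> b <> nxt b ->
  unique_products [seq [:: x; a; b; y] | x <- [:: a; b], y <- [:: a; b]].
Proof.
move=> N1 bE ab anb bnb A B e d A0 B0 Ae Bd; have N0 := ltnW N1.
have [z _] : exists z, W z 0 = a by case: regW => _ _ /(_ a 0) H _; apply: H.
have [k [s [w [sA redw sw Aw]]]] := max_power z A0 Ae.
have [l [t [v [tB redv tv Bv]]]] := max_power z B0 Bd.
(* [a] and [b] cannot both be [nxt] of the last letter of [w]. *)
have [x xab redx] : exists2 x, x \in [:: a; b] & reduced (rcons w x).
  case: (EM (reduced (rcons w a))) => [|na]; first by exists a; rewrite ?mem_head.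
  case: (EM (reduced (rcons w b))) => [|nb].
    by exists b; rewrite // !inE eqxx orbT.
  by case: ab; rewrite (reduced_rcons a N0 redw na) [RHS](reduced_rcons a N0 redw nb).
(* If both letters failed, the head of [v] would equal both [nxt a = b] and [nxt b]; for empty [v]
   the default head gives [b = nxt b] as well. *)
have [y yab redy] : exists2 y, y \in [:: a; b] & reduced (y :: v).
  case: (EM (reduced (a :: v))) => [|na]; first by exists a; rewrite ?mem_head.
  case: (EM (reduced (b :: v))) => [|nb].
    by exists b; rewrite // !inE eqxx orbT.
  have := reduced_cons N0 redv na; have := reduced_cons N0 redv nb.
  case: v {tv redv na nb} => [|c v] /=; first by move=> /bnb.
  by rewrite -bE => -> /esym/bnb.
(* The inner junctions are safe: [a] is [nxt] of neither letter, [nxt b] is neither letter, and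
   [[:: a; b]] is shorter than a window. *)
have red : reduced (w ++ [:: x; a; b; y] ++ v).
  have -> : w ++ [:: x; a; b; y] ++ v = rcons (rcons w x ++ [:: a]) b ++ y :: v.
    by rewrite -cats1 cat_rcons -!catA.
  apply: reduced_cat => //.
    rewrite rcons_cat; apply: reduced_cat => //.
      move=> p r q /(congr1 size); rewrite !size_cat size_win /=; lia.
    by move: xab; rewrite !inE => /orP[/eqP->|/eqP->] //; rewrite -bE.
  by move: yab; rewrite !inE => /orP[/eqP->|/eqP->].
exists s, t, [:: x; a; b; y]; split=> //; first exact: allpairs_f.
move=> s' t' u' sA' tB' uU; have [w' sw'] := Aw _ sA'; have [v' tv'] := Bv _ tB'.
have collect w1 v1 u1 : eqv ((w1 ++ power k z) ++ u1 ++ v1 ++ power l z)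
    ((w1 ++ u1 ++ v1) ++ power k z ++ power l z).
  rewrite -!catA; apply: eqv_catl; rewrite !catA; apply: eqv_catr.
  by rewrite -!catA [u1 ++ v1 ++ _]catA; apply: commute_power.
have norm s1 t1 w1 v1 u1 : eqv s1 (w1 ++ power k z) -> eqv t1 (v1 ++ power l z) ->
    eqv (s1 ++ u1 ++ t1) ((w1 ++ u1 ++ v1) ++ power k z ++ power l z).
  move=> s1w t1v; apply: eqv_trans (collect _ _ _).
  exact/eqv_cat/eqv_catl.
move=> E.
have {}E := eqv_trans (eqv_trans (eqv_sym (norm _ _ _ _ u' sw' tv')) E)
  (norm _ _ _ _ _ sw tv).
(* Once the common power is cancelled, a reduced word is alone in its class: the words are equal and
   split by length. *)
have {E} := reduced_eqv red (eqv_sym (eqv_catrI regW E)) => /eqP.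
have sz : size w' = size w.
  have := eqv_size sw; have := eqv_size sw'.
  by rewrite !size_cat (Ae _ sA) (Ae _ sA'); lia.
have su : size u' = size [:: x; a; b; y].
  by case/allpairsP: uU => -[c c'] [_ _ ->].
rewrite eqseq_cat // => /andP[/eqP Ew].
rewrite eqseq_cat // => /andP[/eqP -> /eqP Ev].
split=> //; first by rewrite -Ew in sw; apply: eqv_trans sw' (eqv_sym sw).
by rewrite -Ev in tv; apply: eqv_trans tv' (eqv_sym tv).
Qed.

End Cyclic.

End Codes.

(** * The monoid as a quotient of words *)

Section WordMonoid.

Variables (X : choiceType) (I : Type) (W : I -> nat -> X) (N : nat).

Definition eqvb (u v : seq X) : bool := `[< eqv W N u v >].

Lemma eqvbP u v : reflect (eqv W N u v) (eqvb u v).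
Proof. exact: asboolP. Qed.

Lemma eqvb_refl : reflexive eqvb.
Proof. by move=> u; apply/eqvbP/eqv_refl. Qed.

Lemma eqvb_sym : symmetric eqvb.
Proof. by move=> u v; apply/eqvbP/eqvbP; apply: eqv_sym. Qed.

Lemma eqvb_trans : transitive eqvb.
Proof. by move=> v u w /eqvbP uv /eqvbP vw; apply/eqvbP/(eqv_trans uv vw). Qed.

Canonical eqvb_equiv := EquivRel eqvb eqvb_refl eqvb_sym eqvb_trans.

Definition word_class := {eq_quot eqvb}%qT.

HB.instance Definition _ := Choice.on word_class.
HB.instance Definition _ := Quotient.on word_class.
HB.instance Definition _ : EqQuotient (seq X) eqvb word_class :=
  EqQuotient.on word_class.

Definition wcl (u : seq X) : word_class := (\pi_word_class u)%qT.

Lemma wclP u v : reflect (eqv W N u v) (wcl u == wcl v).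
Proof. by apply: (iffP eqP) => [/eqmodP/eqvbP|/eqvbP/eqmodP]. Qed.

Lemma wcl_repr (s : word_class) : wcl (repr s) = s.
Proof. by rewrite /wcl reprK. Qed.

Lemma repr_wcl u : eqv W N (repr (wcl u)) u.
Proof. by apply/wclP/eqP; rewrite wcl_repr. Qed.

Definition wcl_mul (s t : word_class) : word_class := wcl (repr s ++ repr t).

Lemma wcl_cat u v : wcl_mul (wcl u) (wcl v) = wcl (u ++ v).
Proof. by apply/eqP/wclP/eqv_cat; apply: repr_wcl. Qed.

Lemma wcl_mulA : associative wcl_mul.
Proof.
by move=> s t r; rewrite -(wcl_repr s) -(wcl_repr t) -(wcl_repr r) !wcl_cat catA.
Qed.

Lemma wcl_mul1 : left_id (wcl [::]) wcl_mul.
Proof. by move=> s; rewrite -(wcl_repr s) wcl_cat. Qed.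

Lemma wcl_mulr1 : right_id (wcl [::]) wcl_mul.
Proof. by move=> s; rewrite -(wcl_repr s) wcl_cat cats0. Qed.

Lemma wcl_unit s t : wcl_mul s t = wcl [::] -> s = wcl [::] /\ t = wcl [::].
Proof.
rewrite -(wcl_repr s) -(wcl_repr t) wcl_cat => /eqP/wclP/eqv_size/eqP.
by rewrite size_cat addn_eq0 !size_eq0 => /andP[/eqP-> /eqP->].
Qed.

HB.instance Definition _ := Choice_isMonomialDef.Build word_class
  wcl_mulA wcl_mul1 wcl_mulr1 wcl_unit.

End WordMonoid.

(** * The monoid algebra *)

Section MalgAlgebra.
Variables (M : monomType) (R : comNzRingType).
Local Open Scope ring_scope.
Import GRing.Theory.
Lemma malg_scaleAr (c : R) (g1 g2 : {malg R[M]}) : c *: (g1 * g2) = g1 * (c *: g2).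
Proof.
apply/malgP => m; rewrite mcoeffZ (mcoeffMlw _ (fsubset_refl _) (msuppZ_le c g2)).
rewrite mcoeffMl mulr_sumr; apply: eq_bigr => k _; rewrite mulr_sumr.
by apply: eq_bigr => l _; rewrite mcoeffZ mulrnAr !mulrA [c * _]mulrC.
Qed.
(* [malg] already carries a commutative algebra structure, but only over
   commutative monoids; the alias is what lets a second one be declared. *)
Definition monoid_algebra : Type := {malg R[M]}.
HB.instance Definition _ := GRing.Lalgebra.on monoid_algebra.
HB.instance Definition _ :=
  GRing.Lalgebra_isAlgebra.Build R monoid_algebra malg_scaleAr.
End MalgAlgebra.

Local Open Scope ring_scope.
Import GRing.Theory.

(** * Evaluation of the monoid algebra in an algebra satisfying the relations *)

Section Evaluation.

Variables (X : choiceType) (I : Type) (W : I -> nat -> X) (N : nat).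
Variables (K : fieldType) (A : algType K) (a : X -> A).
Hypothesis aW : forall s t,
  \prod_(x <- win W N s) a x = \prod_(x <- win W N t) a x.

Let S := word_class W N.

Definition eval_class (s : S) : A := \prod_(x <- repr s) a x.

Lemma eval_eqv u v : eqv W N u v -> \prod_(x <- u) a x = \prod_(x <- v) a x.
Proof. by elim=> // p s t q _ ->; rewrite !big_cat /= (aW s t). Qed.

Lemma eval_wcl u : eval_class (wcl W N u) = \prod_(x <- u) a x.
Proof. exact/eval_eqv/repr_wcl. Qed.

Fact eval_class_morphism : mmorphism eval_class.
Proof.
split=> [s t|]; last by rewrite -[mone]/(wcl W N [::]) eval_wcl big_nil.
by rewrite -[mmul s t]/(wcl W N _) eval_wcl big_cat.
Qed.

HB.instance Definition _ := isMultiplicative.Build S A eval_class eval_class_morphism.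

Definition eval (g : monoid_algebra S K) : A := mmap (in_alg A) eval_class g.

Fact eval_additive : additive eval.
Proof. exact: mmap_is_additive. Qed.

Fact eval_multiplicative : multiplicative eval.
Proof.
apply: commr_mmap_is_multiplicative => g m m'.
by rewrite /GRing.comm /= -scalerAl mul1r -scalerAr mulr1.
Qed.

Fact eval_scalable : scalable eval.
Proof. by move=> c g; rewrite /eval mmapZ /= -scalerAl mul1r. Qed.

HB.instance Definition _ := GRing.isAdditive.Build _ _ eval eval_additive.
HB.instance Definition _ := GRing.isMultiplicative.Build _ _ eval eval_multiplicative.
HB.instance Definition _ := GRing.isScalable.Build K _ _ *:%R eval eval_scalable.

Definition eval_lrmorphism : {lrmorphism monoid_algebra S K -> A} := eval.

Lemma eval_lrmorphismU u : eval_lrmorphism << wcl W N u >> = \prod_(x <- u) a x.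
Proof. by rewrite /= /eval mmapU /= scale1r mul1r eval_wcl. Qed.

End Evaluation.

(** * Words of maximal length in a product *)

Lemma addn_maxE p q e d l : (p <= e)%N -> (q <= d)%N ->
  (p + (l + q) = e + l + d)%N ->
  p = e /\ q = d.
Proof. by lia. Qed.

Section UniqueProducts.

Variables (X : choiceType) (I : Type) (W : I -> nat -> X) (N : nat).
Variable (K : fieldType).

Let S := word_class W N.
Let B := monoid_algebra S K.

Lemma prod_letters u : \prod_(x <- u) (<< wcl W N [:: x] >> : B) = << wcl W N u >>.
Proof.
elim: u => [|x u IH]; first by rewrite big_nil.
rewrite big_cons IH -[LHS]/(fgmul _ _) fgmulUU mul1r.
by rewrite -[mmul _ _]/(wcl_mul _ _) wcl_cat.
Qed.

Let len (s : S) := size (repr s).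

Let len_wcl u : len (wcl W N u) = size u.
Proof. exact/eqv_size/repr_wcl. Qed.

Let wcl_mulE u v : mmul (wcl W N u) (wcl W N v) = wcl W N (u ++ v).
Proof. exact: wcl_cat. Qed.

Let sum_delta (T : eqType) (s : seq T) (F : T -> K) (k0 : T) :
  uniq s -> k0 \in s -> \sum_(k <- s) F k *+ (k == k0) = F k0.
Proof.
move=> us k0s; rewrite (bigD1_seq k0) //= eqxx big1 ?addr0 // => k /negbTE ->.
by rewrite mulr0n.
Qed.

Let top (g : B) : g != 0 -> exists e, exists2 k, k \in msupp g &
  len k = e /\ forall k', k' \in msupp g -> (len k' <= e)%N.
Proof.
move=> g0; have /seq_argmax : (msupp g : seq S) != [::].
  apply: contra g0 => /eqP E; rewrite -msupp_eq0; apply/eqP/fsetP => k.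
  by rewrite inE -[RHS]/(k \in [::]) -E.
by move=> /(_ len) [k kg kmax]; exists (len k), k.
Qed.

(* The coefficient of [y * (r * x)] at the unique product of words of maximal
   length is nonzero, so [y * (r * x)] has larger degree than [y]. *)
Lemma no_left_inverse (U : seq (seq X)) l (x y : B) :
  (0 < l)%N -> (forall u, u \in U -> size u = l) -> unique_products W N U ->
  x != 0 -> y * (1 - (\sum_(u <- undup U) << wcl W N u >>) * x) <> 1.
Proof.
move=> l0 Ul upU x0 yE; set r := \sum_(u <- _) _ in yE.
have y0 : y != 0.
  by apply/eqP => y0; move/eqP: yE; rewrite y0 mul0r eq_sym oner_eq0.
have E : y * (r * x) = y - 1.
  by rewrite -yE mulrBr mulr1 opprB addrC subrK.
have [e [ke key [eE emax]]] := top y0; have [d [kd kdx [dE dmax]]] := top x0.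
pose A := [seq repr k | k <- msupp y & len k == e].
pose C := [seq repr k | k <- msupp x & len k == d].
have memA k : k \in msupp y -> len k = e -> repr k \in A.
  by move=> ky ke'; apply: map_f; rewrite mem_filter ke' eqxx.
have memC k : k \in msupp x -> len k = d -> repr k \in C.
  by move=> ky ke'; apply: map_f; rewrite mem_filter ke' eqxx.
have [||||s [t [u [sA tC uU uniq_stu]]]] := upU A C e d.
- by apply/eqP => A0; have := memA _ key eE; rewrite A0.
- by apply/eqP => A0; have := memC _ kdx dE; rewrite A0.
- by move=> w /mapP[k]; rewrite mem_filter => /andP[/eqP <- _] ->.
- by move=> w /mapP[k]; rewrite mem_filter => /andP[/eqP <- _] ->.
have [ks ksy sE] : exists2 k, k \in msupp y & s = repr k /\ len k = e.
  by case/mapP: sA => k; rewrite mem_filter => /andP[/eqP <- ky] ->; exists k.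
have [kt ktx tE] : exists2 k, k \in msupp x & t = repr k /\ len k = d.
  by case/mapP: tC => k; rewrite mem_filter => /andP[/eqP <- ky] ->; exists k.
pose g := wcl W N (s ++ u ++ t).
have leng : (len g = e + l + d)%N.
  case: sE tE => sE <- [tE <-].
  by rewrite len_wcl !size_cat (Ul _ uU) sE tE addnA.
(* Length forces a product equal to [g] to use words of top length only, where the unique product
   property applies. *)
have key_eq k v m : k \in msupp y -> v \in U -> m \in msupp x ->
    (mmul k (mmul (wcl W N v) m) == g) = [&& k == ks, v == u & m == kt].
  move=> ky vU mx; apply/idP/idP => [/eqP H|/and3P[/eqP-> /eqP-> /eqP->]]; last first.
    case: sE => sE _; case: tE => tE _.
    by rewrite -(wcl_repr ks) -(wcl_repr kt) -sE -tE !wcl_mulE.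
  have := congr1 len H; rewrite leng -(wcl_repr k) -(wcl_repr m) !wcl_mulE.
  rewrite len_wcl !size_cat (Ul _ vU) => Hs.
  have [ke' md] := addn_maxE (emax _ ky) (dmax _ mx) Hs.
  have kA := memA _ ky ke'; have mC := memC _ mx md.
  have [|] := uniq_stu _ _ _ kA mC vU.
    by apply/wclP; rewrite -/g -H -!wcl_mulE !wcl_repr.
  move=> /wclP/eqP Es /wclP/eqP Et ->.
  case: sE => sE _; case: tE => tE _.
  rewrite -(wcl_repr k) Es sE -(wcl_repr m) Et tE.
  by rewrite !wcl_repr !eqxx.
(* By [key_eq] a single term of the triple sum survives. *)
have coefE : (y * (r * x))@_g = y@_ks * x@_kt.
  have distr (b c : B) :
      b * (c * x) = \sum_(m <- msupp x) b * (c * << x@_m *g m >>).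
    rewrite {1}(monalgE x) (mulr_sumr _ _ _ c).
    exact: mulr_sumr.
  have -> : y * (r * x) = \sum_(k <- msupp y) \sum_(v <- undup U)
      \sum_(m <- msupp x) << y@_k * x@_m *g mmul k (mmul (wcl W N v) m) >>.
    rewrite {1}(monalgE y) mulr_suml; apply: eq_bigr => k _.
    rewrite /r mulr_suml mulr_sumr; apply: eq_bigr => v _.
    rewrite distr; apply: eq_bigr => m _.
    rewrite -[X in _ * X = _]/(fgmul _ _) fgmulUU mul1r.
    by rewrite -[LHS]/(fgmul _ _) fgmulUU.
  rewrite raddf_sum /=.
  rewrite -(sum_delta (fun k => y@_k * x@_kt) (fset_uniq (msupp y)) ksy).
  apply: eq_big_seq => k ky.
  have uU' : u \in undup U by rewrite mem_undup.
  rewrite raddf_sum /=.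
  rewrite -(sum_delta (fun=> y@_k * x@_kt *+ (k == ks)) (undup_uniq U) uU').
  apply: eq_big_seq => v; rewrite mem_undup => vU.
  rewrite raddf_sum /= -(sum_delta
    (fun m => y@_k * x@_m *+ (k == ks) *+ (v == u)) (fset_uniq (msupp x)) ktx).
  apply: eq_big_seq => m mx; rewrite mcoeffU key_eq //.
  by case: (k == ks) (v == u) (m == kt) => -[] []; rewrite ?mulr0n ?mul0rn ?mulr1n.
(* [g] is nonempty and longer than every word of [y]. *)
have : (y - 1)@_g = 0.
  rewrite mcoeffB mcoeff1.
  have -> : (g == mone) = false.
    apply/negP => /eqP /(congr1 len).
    rewrite leng -[mone]/(wcl W N [::]) len_wcl => /eqP.
    by rewrite !addn_eq0 (gtn_eqF l0) andbF.
  rewrite subr0; apply: mcoeff_outdom; apply/negP => /emax.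
  by rewrite leng -addnA -{2}[e]addn0 leq_add2l leqn0 addn_eq0 (gtn_eqF l0).
rewrite -E coefE => /eqP; rewrite mulf_eq0 !mcoeff_eq0 ksy ktx.
by [].
Qed.

End UniqueProducts.

(** * Maximal left ideals and the Jacobson radical *)

Section Jacobson.

Variable R : pzRingType.

Lemma maximal_left_ideal_exists (L : R -> Prop) : left_ideal L -> ~ L 1 ->
  exists2 M, maximal_left_ideal M & forall x, L x -> M x.
Proof.
move=> [L0 LD LM] L1.
(* Adjoining [L] to each set makes the empty chain harmless. *)
pose P (A : set R) := left_ideal (A `|` L)%classic /\ ~ (A `|` L)%classic 1.
have [|A [[idA A1] maxA]] := @Zorn_bigcup R P.
  move=> F FP totF.
  have common x y : (\bigcup_(X in F) X `|` L)%classic x ->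
      (\bigcup_(X in F) X `|` L)%classic y ->
      (L x /\ L y) \/ exists2 X, F X & (X `|` L)%classic x /\ (X `|` L)%classic y.
    move=> [[X FX Xx]|Lx] [[Y FY Yy]|Ly].
    - by have [XY|YX] := totF X Y FX FY; right; [exists Y => // | exists X => //];
        split; left => //; [apply: XY | apply: YX].
    - by right; exists X => //; split; [left | right].
    - by right; exists Y => //; split; [right | left].
    - by left.
  have up X x : F X -> (X `|` L)%classic x -> (\bigcup_(X in F) X `|` L)%classic x.
    by move=> FX [Xx|]; [left; exists X | right].
  split; [split; first by right|].
  - move=> x y Ux Uy; case: (common x y Ux Uy) => [[Lx Ly]|[X FX [Xx Xy]]].
      by right; apply: LD.
    by apply: (up X) => //; case: (FP X FX) => -[_ + _] _; apply.
  - move=> r x Ux; case: (common x x Ux Ux) => [[Lx _]|[X FX [Xx _]]].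
      by right; apply: LM.
    by apply: (up X) => //; case: (FP X FX) => -[_ _ +] _; apply.
  move=> U1; case: (common 1 1 U1 U1) => [[]//|[X FX [X1 _]]].
  by case: (FP X FX).
exists (A `|` L)%classic; last by move=> x; right.
split=> // J idJ J1 AJ x Jx; apply: contrapT => nAx.
have JL : (J `|` L)%classic = J.
  by apply/seteqP; split=> [z [//|Lz]|z Jz]; [apply: AJ; right | left].
apply: (maxA J); last by rewrite /P JL.
by split=> [z Az|JA]; [apply: AJ; left | apply: nAx; left; apply: JA].
Qed.

(** Otherwise the left ideal generated by [1 - r * x] lies in a maximal one, which contains [x] and
    hence [1]. *)
Lemma jacobson_left_inverse (x r : R) : jacobson x -> exists y, y * (1 - r * x) = 1.
Proof.
move=> Jx; apply: contrapT => none.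
pose L z := exists y, z = y * (1 - r * x).
have [||M maxM LM] := @maximal_left_ideal_exists L.
- split=> [|z w [y ->] [y' ->]|c z [y ->]]; first by exists 0; rewrite mul0r.
    by exists (y + y'); rewrite mulrDl.
  by exists (c * y); rewrite mulrA.
- by case=> y E; apply: none; exists y.
have Mx := Jx M maxM; case: maxM => [[M0 MD MM] M1 _]; apply: M1.
rewrite -(subrK (r * x) 1); apply: MD (MM r x Mx).
by apply: LM; exists 1; rewrite mul1r.
Qed.

End Jacobson.

(** * Windows of an abelian permutation group *)

Section PermutationWindows.

Variables (N : nat) (H : {group 'S_N.+1}).

Definition perm_window (s : subg_of H) (i : nat) : 'I_N.+1 := sgval s (inord i).

Local Notation W := perm_window.

Lemma win_perm s : win W N s = [seq sgval s i | i <- enum 'I_N.+1].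
Proof.
rewrite /win /mkseq -val_enum_ord -map_comp; apply: eq_map => i.
by rewrite /= /perm_window inord_val.
Qed.

Lemma prod_win (R : pzSemiRingType) (b : 'I_N.+1 -> R) s :
  \prod_(x <- win W N s) b x = \prod_(i < N.+1) b (sgval s i).
Proof. by rewrite win_perm big_map enumT [index_enum _]unlock. Qed.

(** This is the orbit of [x] under [H]. *)
Definition sym_class (x : 'I_N.+1) : {set 'I_N.+1} := [set (s : 'S_N.+1) x | s in H].

Lemma sym_class_perm_window s i : sym_class (W s i) = sym_class (inord i).
Proof.
apply/setP => y; apply/imsetP/imsetP => -[t tH ->].
  by exists (sgval s * t)%g; rewrite ?groupM ?subgP // permM.
exists ((sgval s)^-1 * t)%g; rewrite ?groupM ?groupV ?subgP //.
by rewrite permM permK.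
Qed.

Lemma mem_sym_class x : x \in sym_class x.
Proof. by apply/imsetP; exists 1%g; rewrite ?group1 ?perm1. Qed.

Hypothesis abH : abelian H.

Section Transitive.

Hypothesis trH : forall x y, exists2 s : 'S_N.+1, s \in H & s x = y.

Let commH (s t : 'S_N.+1) x : s \in H -> t \in H -> s (t x) = t (s x).
Proof.
by move=> sH tH; rewrite -!permM; congr (fun_of_perm _ _); apply: (centsP abH).
Qed.

(** An element of [H] carrying [x] to [y] commutes with [s] and [t], so agreement at [x] spreads to
    [y]. *)
Let freeH (s t : 'S_N.+1) x : s \in H -> t \in H -> s x = t x -> s = t.
Proof.
move=> sH tH E; apply/permP => y; have [r rH <-] := trH x y.
by rewrite !(commH _ _ rH) // E.
Qed.

Lemma regular_perm_windows : regular_windows W N.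
Proof.
split=> [s i j iN jN /perm_inj /(congr1 val)|s t i iN|x i iN|s t s' t' i j i' j' _].
- by rewrite /= !inordK.
- by move=> E; apply: val_inj; apply: freeH E; apply: subgP.
- by have [s sH E] := trH (inord i) x; exists (subg H s); rewrite /perm_window subgK.
rewrite /perm_window => E1 E2 E3.
(* Both ratios send [i] to [j], so they coincide by freeness. *)
have : (sgval s * (sgval t)^-1 = sgval s' * (sgval t')^-1)%g.
  apply: (@freeH _ _ (inord i)); rewrite ?groupM ?groupV ?subgP //.
  by rewrite !permM E1 E3 !permK.
move/(congr1 (fun r : 'S_N.+1 => r (inord i'))); rewrite !permM E2 permK => ->.
by rewrite permKV.
Qed.

Lemma perm_eq_win s t : perm_eq (win W N s) (win W N t).
Proof.
have permE (r : 'S_N.+1) : perm_eq [seq r i | i <- enum 'I_N.+1] (enum 'I_N.+1).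
  apply: uniq_perm => [||x]; last 1 first.
  - rewrite mem_enum; apply/mapP; exists ((r^-1)%g x); first exact: mem_enum.
    by rewrite permKV.
  - by rewrite (map_inj_uniq perm_inj) enum_uniq.
  - exact: enum_uniq.
by rewrite !win_perm (perm_trans (permE _)) // perm_sym.
Qed.

Lemma transitive_unique_products : exists U l,
  [/\ (0 < l)%N, forall u, u \in U -> size u = l & unique_products W N U].
Proof.
have reg := regular_perm_windows; case: (leqP N 1) => N1.
  exists [:: [:: ord0]], 1%N; split=> // [u|]; first by rewrite inE => /eqP ->.
  have two (x y : 'I_N.+1) : x != ord0 -> y != ord0 -> x = y.
    rewrite -!val_eqE /= => x0 y0; apply: val_inj => /=.
    by have := ltn_ord x; have := ltn_ord y; lia.
  apply: unique_products_count two => [|x y]; first exact: perm_eq_win.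
  have [->|xy] := eqVneq x y; first exact: eqv_refl.
  have NE : N = 1%N.
    by move: xy (ltn_ord x) (ltn_ord y); rewrite -val_eqE /=; lia.
  (* On two letters both orders are windows, so the letters commute. *)
  have pair (u v : 'I_N.+1) : u != v -> exists s, win W N s = [:: u; v].
    move=> uv; case: reg => un _ /(_ u 0%N (leq0n N)) [s su] _; exists s.
    have -> : win W N s = mkseq (W s) 2 by congr mkseq; lia.
    rewrite /mkseq /= su; congr [:: _; _].
    have : W s 1 != u.
      by apply/eqP; rewrite -su => /un E; suff: 1%N = 0%N by []; apply: E; lia.
    move: uv (ltn_ord u) (ltn_ord v) (ltn_ord (W s 1)).
    by rewrite -!val_eqE /= => uv un1 vn1 w1 wu; apply: val_inj => /=; lia.
  have [s <-] := pair x y xy; have [t <-] : exists t, win W N t = [:: y; x].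
    by apply: pair; rewrite eq_sym.
  exact: eqv_win.
case: (EM (shifted_window W N)) => [|nsh]; last first.
  exists [:: [:: ord0; ord0; ord0; ord0]], 4%N.
  split=> // [u|]; first by rewrite inE => /eqP ->.
  exact/separating_unique/separating_power.
(* Permutations compose from left to right, so the overlap makes [c] send each position below [N] to
   the next. *)
move=> [s [t st]]; pose c : 'S_N.+1 := (sgval t * (sgval s)^-1)%g.
have cH : c \in H by rewrite groupM ?groupV ?subgP.
have cS i : (i < N)%N -> c (inord i) = inord i.+1.
  move=> iN; apply: (@perm_inj _ (sgval s)); rewrite permM permKV.
  by have := st _ iN; rewrite /perm_window => ->.
have cN : c (inord N) = ord0.
  set j := (c^-1)%g ord0; have cj : c j = ord0 by rewrite permKV.
  (* A preimage of [ord0] below [N] would have [0] as its successor. *)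
  have [jN|jN] := ltnP j N; last first.
    have <- : j = inord N; last by [].
    by apply: val_inj; rewrite /= inordK //; have := ltn_ord j; lia.
  have := cS _ jN; rewrite inord_val cj => /(congr1 val).
  by rewrite /= inordK.
(* As [1 < N], the cycle sends [0] to [1] and [1] to [2], a third letter. *)
exists [seq [:: x; inord 0; inord 1; y] |
         x <- [:: inord 0; inord 1], y <- [:: inord 0; inord 1]], 4%N.
split=> // [u /allpairsP[p [_ _ ->]] //|].
have inordN i j : (i <= N)%N -> (j <= N)%N -> i != j ->
    (inord i : 'I_N.+1) <> inord j.
  by move=> iN jN /eqP ij /(congr1 val); rewrite /= !inordK.
apply: (@unique_products_cyclic _ _ _ _ c) => //.
- by move=> r i iN; rewrite /perm_window -(cS _ iN) (commH _ (subgP r) cH).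
- move=> r; have crH : (c * sgval r)%g \in H by rewrite groupM ?subgP.
  exists (subg H (c * sgval r)%g) => [i iN|].
    by rewrite /perm_window subgK // permM cS.
  rewrite /perm_window subgK // permM cN.
  by congr (sgval r _); apply: val_inj; rewrite /= inordK.
- by rewrite cS // ltnW.
- by apply: inordN => //; lia.
- by rewrite cS //; apply: inordN => //; lia.
- by rewrite cS //; apply: inordN => //; lia.
Qed.

End Transitive.

Lemma abelian_unique_products : exists U l,
  [/\ (0 < l)%N, forall u, u \in U -> size u = l & unique_products W N U].
Proof.
have [tr|] := boolP [forall x, sym_class x == sym_class ord0].
  apply: transitive_unique_products => x y.
  have : y \in sym_class x.
    by rewrite (eqP (forallP tr x)) -(eqP (forallP tr y)) mem_sym_class.
  by case/imsetP => s sH ->; exists s.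
rewrite negb_forall => /existsP[a an0].
(* If the first and last letters share an orbit, [a] lies outside it; otherwise the first letter
   lies outside the orbit of the last. *)
have [b bnN] : exists b, sym_class b != sym_class (inord N).
  have [E|] := eqVneq (sym_class ord0) (sym_class (inord N)).
    by exists a; rewrite -E.
  by exists ord0.
have N0 : (0 < N)%N.
  rewrite lt0n; apply/eqP => N0; case/eqP: an0; congr sym_class.
  by apply: val_inj => /=; have := ltn_ord a; lia.
exists [:: nseq N b ++ nseq N a], (N + N)%N; split.
- by rewrite addn_gt0 N0.
- by move=> u; rewrite inE => /eqP ->; rewrite size_cat !size_nseq.
apply: separating_unique; apply: (separating_class (cls := sym_class)).
- by move=> s t i _; rewrite !sym_class_perm_window.
- move=> s; rewrite sym_class_perm_window => E; case/eqP: an0; rewrite -E.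
  by congr sym_class; apply: val_inj; rewrite /= inordK.
- by move=> s; rewrite sym_class_perm_window => E; case/eqP: bnN.
Qed.

End PermutationWindows.

(** * Transfer to the presented algebra *)

Theorem theorem4p9 (K : fieldType) (n : nat) (H : {group 'S_n})
    (A : algType K) (a : 'I_n -> A) :
  (1 <= n)%N -> abelian H -> presents_SnH H a ->
  forall x : A, jacobson x -> x = 0.
Proof.
case: n H a => // N H a _ abH [aH univ] x Jx.
have [U [l [l0 Ul upU]]] := abelian_unique_products abH.
pose S := word_class (@perm_window N H) N.
have [f [fa _]] : exists f : {lrmorphism A -> monoid_algebra S K},
    (forall i, f (a i) = << wcl (@perm_window N H) N [:: i] >>) /\ True.
  have [|f [fa _]] := univ (monoid_algebra S K) (fun i => << wcl _ N [:: i] >>).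
    move=> s sH.
    have E (r : subg_of H) :
        \prod_(i < N.+1) << wcl (@perm_window N H) N [:: sgval r i] >> =
        << wcl _ N (win (@perm_window N H) N r) >> :> monoid_algebra S K.
      rewrite -prod_letters; apply: esym.
      exact: (@prod_win N H (monoid_algebra S K) (fun x => << wcl _ N [:: x] >>)).
    have := E 1%g; have := E (subg H s); rewrite subgK // => -> E1.
    transitivity (<< wcl (@perm_window N H) N (win (@perm_window N H) N 1%g) >> :
        monoid_algebra S K).
      by rewrite -E1; apply: eq_bigr => i _; rewrite /= perm1.
    by congr mkmalgU; apply/eqP/wclP/eqv_win.
  by exists f.
have aW s t : \prod_(i <- win (@perm_window N H) N s) a i =
    \prod_(i <- win (@perm_window N H) N t) a i.
  by rewrite !prod_win -!aH ?subgP.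
(* Uniqueness in the universal property makes evaluation a left inverse of [f], so [f] is
   injective. *)
have fK y : eval_lrmorphism aW (f y) = y.
  have [h [_ huniq]] := univ A a aH.
  have := huniq (eval_lrmorphism aW \o f).
  have := huniq (idfun : {lrmorphism A -> A}).
  move=> /(_ (fun=> erefl)) H1 H2; rewrite [RHS]H1 -H2 // => i /=.
  by rewrite fa; apply: etrans (eval_lrmorphismU aW _) _; apply: big_seq1.
apply/eqP/negPn/negP => x0.
have fx0 : f x != 0.
  by apply: contra x0 => /eqP E; rewrite -(fK x) E raddf0.
pose r := \sum_(u <- undup U) \prod_(i <- u) a i.
have [y yE] := jacobson_left_inverse r Jx.
(* The left inverse of [1 - r * x] is carried to the monoid algebra by [f]. *)
apply: (no_left_inverse (y := f y) l0 Ul upU fx0).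
have -> : \sum_(u <- undup U) << wcl (@perm_window N H) N u >> = f r.
  rewrite raddf_sum; apply: eq_bigr => u _.
  rewrite -prod_letters; apply: esym.
  apply: etrans (big_morph f (rmorphM f) (rmorph1 f) _ _ _) _.
  by apply: eq_bigr => i _; rewrite fa.
by rewrite -rmorphM -(rmorph1 f) -rmorphB -rmorphM yE.
Qed.
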